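(* Let $t \ge 1$ be an integer, and let $H_t$ be the graph consisting of $2t+1$ pairwise vertex-disjoint triangles $T_1,\dots,T_{2t+1}$ and one further vertex $v$, where $v$ is adjacent to precisely one vertex $v_i$ of each triangle $T_i$ (joined to it by a single edge). Then ${\cal S}(H_t) = \{3 + \frac{2}{t}\}$ and $\overline{{\cal S}}(H_t) = \{5\}$. Furthermore, $H_t$ has (for some signature) an integer nowhere-zero $5$-flow $\phi$ such that $\phi(e) \in \{1,2,4\}$ for all $e \in E(H_t)$, and $H_t$ has (for some signature) a $(3+\frac{2}{t})$-flow $\phi_c$ such that $\phi_c(e) \in \{1, 1+\frac{1}{t}, 2, 2+\frac{2}{t}\}$ for all $e \in E(H_t)$.
   Context: Graphs are finite and may have parallel edges but no loops. A signed graph $(G,\sigma)$ is a graph $G$ with a function (signature) $\sigma: E(G)\to\{\pm1\}$. Each edge $e=uv$ is divided into two half-edges $h_e^u$ (incident with $u$) and $h_e^v$ (incident with $v$); $H(G)$ is the set of half-edges, $H(v)$ the set of half-edges incident with $v$, and $e_h$ the edge containing the half-edge $h$. An orientation of $(G,\sigma)$ is a function $\tau: H(G)\to\{\pm1\}$ with $\tau(h_e^u)\tau(h_e^v) = -\sigma(e)$ for each edge $e=uv$. Given an orientation $\tau$, the boundary of $f:E(G)\to\mathbb{R}$ is $\delta f(v)=\sum_{h\in H(v)}\tau(h)f(e_h)$. For real $r\ge 2$, $f$ is an $r$-flow on $(G,\sigma)$ if, for every edge $e$, $f(e)=0$ or $1\le |f(e)|\le r-1$, and $\delta f(v)=0$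 for all $v\in V(G)$; it is nowhere-zero if $f(e)\ne 0$ for all $e$. $(G,\sigma)$ admits a nowhere-zero $r$-flow if one exists for some orientation, and $(G,\sigma)$ is flow-admissible if it admits a nowhere-zero $r$-flow for some $r\ge2$. $F_c((G,\sigma))=\inf\{r : (G,\sigma)\text{ admits a nowhere-zero }r\text{-flow}\}$, and $F((G,\sigma))$ is the smallest integer $k$ such that $(G,\sigma)$ admits an integer-valued nowhere-zero $k$-flow (both are $\infty$ if $(G,\sigma)$ is not flow-admissible). The flow spectrum ${\cal S}(G)$ is the set of all $F_c((G,\sigma))$, and the integer flow spectrum $\overline{{\cal S}}(G)$ the set of all $F((G,\sigma))$, where $\sigma$ ranges over all signatures of $G$ for which $(G,\sigma)$ is flow-admissible. *)

(* Defs.v *)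
From HB Require Import structures.
From mathcomp Require Import all_boot all_order all_algebra.
From mathcomp Require Import all_classical all_reals ereal.

Set Implicit Arguments.
Unset Strict Implicit.
Unset Printing Implicit Defensive.

Import Order.TTheory GRing.Theory Num.Theory.
Local Open Scope classical_set_scope.
Local Open Scope ring_scope.

(* Distinct edges may have the same set of ends, so parallel edges are
   allowed; the cardinality condition excludes loops. *)
Record mgraph := MGraph {
  vertex : finType;
  edge : finType;
  ends : edge -> {set vertex};
  card_ends : forall e, #|ends e| = 2%N }.

(* The half-edge h_e^u is the pair (e, u) with u an end of e. *)
Definition halfedge (G : mgraph) :=
  {h : edge G * vertex G | h.2 \in ends h.1}.

Definition he_edge (G : mgraph) (h : halfedge G) : edge G := (val h).1.
Definition he_vertex (G : mgraph) (h : halfedge G) : vertex G := (val h).2.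

Definition signature (G : mgraph) (sigma : edge G -> int) : Prop :=
  forall e, sigma e = 1 \/ sigma e = -1.

Definition orientation (G : mgraph) (sigma : edge G -> int)
    (tau : halfedge G -> int) : Prop :=
  (forall h, tau h = 1 \/ tau h = -1) /\
  (forall h h' : halfedge G, h != h' -> he_edge h = he_edge h' ->
     tau h * tau h' = - sigma (he_edge h)).

Section Flows.
Variables (R : realType) (G : mgraph).
Implicit Types (sigma : edge G -> int) (tau : halfedge G -> int).
Implicit Types (f : edge G -> R) (r : R) (k : nat).

Definition boundary tau f (v : vertex G) : R :=
  \sum_(h : halfedge G | he_vertex h == v) (tau h)%:~R * f (he_edge h).

Definition is_flow tau r f : Prop :=
  [/\ 2 <= r,
      forall e, f e = 0 \/ 1 <= `|f e| <= r - 1 &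
      forall v, boundary tau f v = 0].

Definition nowhere_zero f : Prop := forall e, f e != 0.

Definition integer_valued f : Prop := forall e, f e \is a Num.int.

Definition admits_nz_flow sigma r : Prop :=
  exists tau f, [/\ orientation sigma tau, is_flow tau r f & nowhere_zero f].

Definition admits_int_nz_flow sigma k : Prop :=
  exists tau f, [/\ orientation sigma tau, is_flow tau k%:R f,
                    nowhere_zero f & integer_valued f].

Definition flow_admissible sigma : Prop := exists r, admits_nz_flow sigma r.

(* The infimum of the empty set is +oo. *)
Definition circular_flow_number sigma : \bar R :=
  ereal_inf (EFin @` [set r | admits_nz_flow sigma r]).

Definition integer_flow_number sigma : \bar nat :=
  if pselect (exists k, `[< admits_int_nz_flow sigma k >]) is left exk
  then EFin (ex_minn exk) else +oo%E.

Definition flow_spectrum : set (\bar R) :=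
  [set circular_flow_number sigma |
     sigma in [set sigma | signature sigma /\ flow_admissible sigma]].

Definition integer_flow_spectrum : set (\bar nat) :=
  [set integer_flow_number sigma |
     sigma in [set sigma | signature sigma /\ flow_admissible sigma]].

End Flows.

Arguments flow_spectrum R G : clear implicits.
Arguments integer_flow_spectrum R G : clear implicits.

Section TriangleGraph.
Variable t : nat.

(* None is the vertex v; Some (i, j) is the j-th vertex of the triangle T_i,
   and v_i is Some (i, ord0). *)
Definition H_vertex : finType := option ('I_(2 * t + 1) * 'I_3).

(* inl i is the edge v v_i; inr (i, j) is the edge of T_i opposite to its
   j-th vertex. *)
Definition H_edge : finType := ('I_(2 * t + 1) + 'I_(2 * t + 1) * 'I_3)%type.

Definition H_ends (e : H_edge) : {set H_vertex} :=
  match e with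
  | inl i => [set None; Some (i, ord0)]
  | inr (i, j) => [set Some (i, k) | k in [set~ j]]
  end%SET.

Lemma card_H_ends e : #|H_ends e| = 2%N.
Proof.
case: e => [i|[i j]] /=; first by rewrite cards2.
by rewrite card_imset ?cardsC1 ?card_ord // => k k' [].
Qed.

Definition H_graph : mgraph := MGraph card_H_ends.

End TriangleGraph.

(* Main.v *)
Require Import Defs.
From HB Require Import structures.
From mathcomp Require Import all_boot all_order all_algebra lra zify.
From mathcomp Require Import all_classical all_reals ereal.

Set Implicit Arguments.
Unset Strict Implicit.
Unset Printing Implicit Defensive.

Import Order.TTheory GRing.Theory Num.Theory.
Local Open Scope classical_set_scope.
Local Open Scope ring_scope.

(** The bridge [v v_i] and the triangle [T_i] are rigid: conservation at the
    vertices of [T_i] forces all three edges of [T_i] to carry the same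
    absolute value x, and the bridge to carry 2x ([bridge_twice]).  So in a
    nowhere-zero r-flow the bridges have absolute values between 2 and r - 1,
    and their 2t + 1 signed values sum to zero at [v].  One of the two signs
    occurs at least t + 1 times, whence 2 (t + 1) <= (r - 1) t
    ([odd_balance]), which is r >= 3 + 2 / t.  For an integer r <= 4, the even
    numbers 2x <= 3 are all equal to 2, and the same inequality, now with 2 in
    place of r - 1, fails; hence r >= 5.

    Both bounds are attained for every flow-admissible signature.  The
    conservation laws at a triangle are homogeneous, so any nowhere-zero flow
    can be rescaled on each triangle together with its bridge, independently
    of the others: the signed bridge values can be prescribed at will, as long
    as they are nonzero and sum to zero ([prescribe_bridges]).  Taking -2 on
    t + 1 bridges and 2 + 2 / t on the other t gives the bound 3 + 2 / t;
    taking instead 4 once and 2 on the other t - 1 gives 5.  Reversing edges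
    makes all values positive ([reorient_to_norm]), and the edges of a triangle
    carry half the value of its bridge, so these flows take the announced
    values.

    A flow-admissible signature exists: if every edge is negative and all
    half-edges are positive, the values 1, -1, -1 on each triangle and 2 on
    each bridge are conserved at all triangles, which is all that the
    rescaling needs. *)

(** * Boundaries as sums over edges *)

Section Incidence.
Variables (R : realType) (G : mgraph).
Implicit Types (tau : halfedge G -> int) (f : edge G -> R).

(** Extending the half-edge signs by zero to all pairs of an edge and a vertex
    turns a boundary into a sum over all edges. *)
Definition incidence tau e v : R :=
  oapp (fun h : halfedge G => (tau h)%:~R) 0 (insub (e, v)).

Lemma boundaryE tau f v :
  boundary tau f v = \sum_e incidence tau e v * f e.
Proof.
pose F (p : edge G * vertex G) := incidence tau p.1 p.2 * f p.1.
have -> : boundary tau f v = \sum_(h : halfedge G | (val h).2 == v) F (val h).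
  apply: eq_bigr => h _; rewrite /F /incidence -surjective_pairing.
  by rewrite valK.
rewrite -(big_sub_cond [pred p | p.2 \in ends p.1] (fun p => p.2 == v)).
rewrite big_mkcond /= -(pair_bigA _ (fun e u =>
  if (u \in ends e) && (u == v) then F (e, u) else 0)) /=.
apply: eq_bigr => e _; rewrite (bigD1 v) //= eqxx andbT.
rewrite big1 ?addr0 => [|u /negPf->]; last by rewrite andbF.
case: ifP => // ev; rewrite /F /incidence; case: insubP => [h /=|_].
  by rewrite ev.
by rewrite mul0r.
Qed.

Lemma incidence_out tau e v : v \notin ends e -> incidence tau e v = 0.
Proof. by rewrite /incidence; case: insubP => //= h ->. Qed.

Lemma incidence_sign sigma tau e v : orientation sigma tau ->
  v \in ends e -> incidence tau e v = 1 \/ incidence tau e v = -1.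
Proof.
case=> tau1 _ ev; rewrite /incidence; case: insubP => [h _ _|] /=.
  by case: (tau1 h) => ->; [left | right].
by rewrite /= ev.
Qed.

Lemma norm_incidence sigma tau e v : orientation sigma tau ->
  v \in ends e -> `|incidence tau e v| = 1.
Proof.
by move=> ori /(incidence_sign ori)[] ->; rewrite ?normrN normr1.
Qed.

(** Reversing an edge, that is changing the signs of both its half-edges,
    compensates a change of sign of the value there and keeps the product of
    the two half-edge signs. *)
Lemma reorient_to_norm sigma tau f : orientation sigma tau -> exists tau',
  orientation sigma tau' /\
  forall v, boundary tau' (fun e => `|f e|) v = boundary tau f v.
Proof.
case=> tau1 tau2.
exists (fun h => if f (he_edge h) < 0 then - tau h else tau h); split.
  split=> [h|h h' hh' ee]; first by case: ifP => _; case: (tau1 h) => ->; auto.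
  by rewrite -ee -(tau2 _ _ hh' ee); case: ifP; rewrite ?mulrNN.
move=> v; apply: eq_bigr => h _; case: ltP => fh.
  by rewrite ltr0_norm // rmorphN mulrNN.
by rewrite ger0_norm.
Qed.

End Incidence.

(** * Zero sums with an odd number of terms *)

(** One of the two signs occurs at least t + 1 times.  The terms of that sign
    contribute at least m (t + 1) in absolute value, and must be compensated
    by at most t terms of absolute value at most M. *)
Lemma odd_balance (R : realFieldType) (t : nat) (m M : R)
    (s : 'I_(2 * t + 1) -> R) :
  0 <= m -> (forall i, m <= `|s i| <= M) -> \sum_i s i = 0 ->
  m * t.+1%:R <= M * t%:R.
Proof.
move=> m0.
have cardC_N (P : pred 'I_(2 * t + 1)) :
    exists2 q, #|[predC P]| = q & #|P| = (2 * t + 1 - q)%N.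
  exists #|[predC P]| => //.
  by rewrite -[X in (X - _)%N]card_ord -(cardC P) addnK.
(* Negating all terms exchanges the two signs. *)
wlog sp : s / (t < #|[pred i | (0 <= s i)%R]|)%N => [base sB s0|sB s0].
  have [sp|sp] := ltnP t #|[pred i | (0 <= s i)%R]|; first exact: base sp sB s0.
  apply: (base (fun i => - s i)) => [|i|]; first last.
  - by rewrite sumrN s0 oppr0.
  - by rewrite normrN.
  have [q cq cp] := cardC_N [pred i | (0 <= s i)%R].
  apply: (@leq_trans q); first by move: sp; rewrite cp; lia.
  rewrite -cq; apply/subset_leq_card/fintype.subsetP => i.
  by rewrite !inE -ltNge oppr_ge0; exact: ltW.
have M0 : 0 <= M.
  have /card_gt0P[i _] : (0 < #|[pred i | (0 <= s i)%R]|)%N by lia.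
  by have /andP[_ /(le_trans _)->] := sB i.
set P := [pred i | 0 <= s i] in sp *.
have sumP : m * #|P|%:R - M * #|[predC P]|%:R <= 0.
  rewrite -s0 (bigID (mem P)) /= !mulr_natr -sumr_const -[M *+ _]sumr_const.
  rewrite lerD //; first last.
    rewrite -sumrN (eq_bigl (fun i => i \in [predC P])) => [|i]; last first.
      by rewrite !inE.
    apply: ler_sum => i; rewrite !inE -ltNge => si.
    by have /andP[_] := sB i; rewrite ltr0_norm // lerNl.
  apply: ler_sum => i; rewrite inE => si.
  by have /andP[] := sB i; rewrite ger0_norm.
have mP : m * t.+1%:R <= m * #|P|%:R by rewrite ler_wpM2l // ler_nat.
have : M * #|[predC P]|%:R <= M * t%:R.
  rewrite ler_wpM2l // ler_nat.
  by have [q -> cp] := cardC_N P; move: sp; rewrite cp; lia.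
by lra.
Qed.

(** * Boundaries in the graph of triangles *)

Section TriangleFlows.
Variables (R : realType) (t : nat).
Local Notation E := (edge (H_graph t)).
Local Notation N := (2 * t + 1)%N.
Implicit Types (sigma : E -> int) (tau : halfedge (H_graph t) -> int).
Implicit Types (f : E -> R) (i : 'I_N) (j k : 'I_3) (g : 'I_N -> R).
Implicit Types (a : nat -> R) (r m M : R).

Lemma mem_triangle_ends i i' j k :
  (Some (i, k) \in H_ends (inr (i', j))) = (i == i') && (k != j).
Proof.
apply/imsetP/andP => [[k'] + [-> ->]|[/eqP-> kj]]; first by rewrite !inE.
by exists k; rewrite ?inE.
Qed.

Lemma mem_bridge_ends i i' k :
  (Some (i, k) \in H_ends (inl i')) = (i == i') && (k == ord0).
Proof. by rewrite !inE /= [Some _ == _](inj_eq Some_inj). Qed.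

Lemma boundary_center tau f : boundary tau f None =
  \sum_i incidence R tau (inl i) None * f (inl i).
Proof.
rewrite boundaryE big_sumType /= [X in _ + X]big1 ?addr0 // => -[i j] _.
by rewrite incidence_out ?mul0r //; apply/imsetP => -[].
Qed.

Lemma boundary_triangle tau f i k : boundary tau f (Some (i, k)) =
  incidence R tau (inl i) (Some (i, k)) * f (inl i) +
  \sum_j incidence R tau (inr (i, j)) (Some (i, k)) * f (inr (i, j)).
Proof.
rewrite boundaryE big_sumType /=; congr (_ + _).
  rewrite (bigD1 i) //= big1 ?addr0 // => i' i'i.
  by rewrite incidence_out ?mul0r // mem_bridge_ends eq_sym (negPf i'i).
pose F i' j := incidence R tau (inr (i', j)) (Some (i, k)) * f (inr (i', j)).
rewrite (eq_bigr (fun p => F p.1 p.2)) => [|[] //]; rewrite -pair_bigA /=.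
rewrite (bigD1 i) //= [X in _ + X]big1 ?addr0 // => i' i'i.
apply: big1 => j _.
by rewrite /F incidence_out ?mul0r // mem_triangle_ends eq_sym (negPf i'i).
Qed.

(** * The edges of a triangle determine its bridge *)

Definition triangle_conserving tau f : Prop :=
  forall i k, boundary tau f (Some (i, k)) = 0.

(** The two vertices of degree 2 force the three edges of the triangle to have
    a common absolute value x, so conservation at the remaining vertex makes
    the value of the bridge one of 0, 2x, -2x; only 0 is excluded by f being
    nowhere zero. *)
Lemma bridge_twice sigma tau f : orientation sigma tau ->
  triangle_conserving tau f -> nowhere_zero f ->
  forall i j, `|f (inl i)| = 2 * `|f (inr (i, j))|.
Proof.
move=> ori bd fN0 i.
pose a k j := incidence R tau (inr (i, j)) (Some (i, k)).
pose x j := f (inr (i, j)).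
have aS k j : k != j -> a k j = 1 \/ a k j = -1.
  by move=> kj; apply: incidence_sign ori _; rewrite mem_triangle_ends eqxx.
have ak k : a k k = 0.
  by apply: incidence_out; rewrite mem_triangle_ends !eqxx.
have bS : incidence R tau (inl i) (Some (i, ord0)) = 1 \/
          incidence R tau (inl i) (Some (i, ord0)) = -1.
  by apply: incidence_sign ori _; rewrite mem_bridge_ends !eqxx.
have b0 k : k != ord0 -> incidence R tau (inl i) (Some (i, k)) = 0.
  by move=> k0; apply: incidence_out; rewrite mem_bridge_ends eqxx.
pose o1 : 'I_3 := lift ord0 ord0; pose o2 : 'I_3 := lift ord0 (lift ord0 ord0).
have tri k : incidence R tau (inl i) (Some (i, k)) * f (inl i) +
    (a k ord0 * x ord0 + (a k o1 * x o1 + a k o2 * x o2)) = 0.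
  by rewrite -(bd i k) boundary_triangle !big_ord_recl big_ord0 addr0.
have sgn (u v y z : R) : u = 1 \/ u = -1 -> v = 1 \/ v = -1 ->
    u * y + v * z = 0 -> `|y| = `|z|.
  move=> [] -> [] ->; rewrite ?mul1r ?mulN1r => /eqP.
  - by rewrite addr_eq0 => /eqP->; rewrite normrN.
  - by rewrite subr_eq0 => /eqP->.
  - by rewrite addrC subr_eq0 => /eqP->.
  - by rewrite -opprD oppr_eq0 addr_eq0 => /eqP->; rewrite normrN.
have x01 : `|x ord0| = `|x o1|.
  apply: (sgn (a o2 ord0) (a o2 o1)); [exact: aS | exact: aS |].
  by rewrite -(tri o2) b0 // ak !mul0r !(add0r, addr0).
have x02 : `|x ord0| = `|x o2|.
  apply: (sgn (a o1 ord0) (a o1 o2)); [exact: aS | exact: aS |].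
  by rewrite -(tri o1) b0 // ak !mul0r !(add0r, addr0).
have B0 := fN0 (inl i).
have B2 : `|f (inl i)| = 2 * `|x ord0|.
  have := tri ord0; rewrite ak mul0r add0r.
  have pm (y : R) : `|x ord0| = `|y| -> y = x ord0 \/ y = - x ord0.
    by move=> /esym/eqP; rewrite eqr_norm2 => /orP[] /eqP; [left | right].
  have a1 : a ord0 o1 = 1 \/ a ord0 o1 = -1 by apply: aS.
  have a2 : a ord0 o2 = 1 \/ a ord0 o2 = -1 by apply: aS.
  move=> tri0.
  have [/eqP|[->|->]] : f (inl i) = 0 \/ f (inl i) = 2 * x ord0 \/
      f (inl i) = - (2 * x ord0).
  - move: tri0; case: bS a1 a2 (pm _ x01) (pm _ x02)
      => -> [] -> [] -> [] -> [] ->;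
      rewrite ?mul1r ?mulN1r => tri0;
      by [left; lra | right; left; lra | right; right; lra].
  - by rewrite (negPf B0).
  - by rewrite normrM normr_nat.
  - by rewrite normrN normrM normr_nat.
move=> j; rewrite B2 -/(x j); congr (2 * _).
case: (unliftP ord0 j) => [j' ->|-> //].
case: (unliftP ord0 j') => [j'' ->|-> //].
by rewrite ord1.
Qed.

(** * Prescribing the bridge values *)

(** By [bridge_twice], these are the only absolute values compatible with
    absolute values |g i| on the bridges. *)
Definition spread g (e : E) : R :=
  match e with inl i => `|g i| | inr p => `|g p.1| / 2 end.

(** Conservation inside a triangle is homogeneous, so a function conserving at
    the triangles may be rescaled on each triangle and its bridge separately.
    The factors are chosen so that the bridges contribute g i to the boundary
    at the centre. *)
Lemma prescribe_bridges sigma tau f g : orientation sigma tau ->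
  triangle_conserving tau f -> nowhere_zero f -> \sum_i g i = 0 ->
  exists tau', orientation sigma tau' /\
    forall v, boundary tau' (spread g) v = 0.
Proof.
move=> ori fT fN0 g0.
pose d i := incidence R tau (inl i) None * f (inl i).
have inc1 i : `|incidence R tau (inl i) None| = 1.
  by rewrite (norm_incidence R ori) // !inE.
have nd i : `|d i| = `|f (inl i)| by rewrite normrM inc1 mul1r.
have d0 i : d i != 0 by rewrite -normr_eq0 nd normr_eq0.
pose f' (e : E) := g (match e with inl i => i | inr p => p.1 end) /
  d (match e with inl i => i | inr p => p.1 end) * f e.
have [tau' [ori' bd']] := reorient_to_norm f' ori.
exists tau'; split=> // v.
have -> : spread g = (fun e => `|f' e|).
  apply/funext => -[i|[i j]]; rewrite /spread /f' /= normrM normf_div nd.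
    by rewrite divfK ?normr_eq0.
  rewrite (bridge_twice ori fT fN0 i j) invfM.
  by rewrite !mulrA divfK ?normr_eq0.
rewrite bd'; case: v => [[i k]|].
  rewrite -(mulr0 (g i / d i)) -(fT i k) !boundary_triangle mulrDr mulr_sumr.
  by congr (_ + _); [|apply: eq_bigr => j _]; rewrite /f' /= mulrCA.
rewrite boundary_center; apply: etrans g0; apply: eq_bigr => i _.
by rewrite /f' mulrCA -/(d i) divfK.
Qed.

(** The t + 1 values -2 absorb a total of 2 (t + 1) on the other t bridges. *)
Definition bridge_values a i : R := if (i < t)%N then a i else -2.

Lemma sum_bridge_values a :
  \sum_(0 <= n < t) a n = 2 * t.+1%:R -> \sum_i bridge_values a i = 0.
Proof.
move=> sa; rewrite -(big_mkord xpredT (fun n => if (n < t)%N then a n else -2)).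
rewrite (@big_cat_nat _ _ _ t) //=; last by lia.
rewrite big_nat (eq_bigr a) => [|n /andP[_ ->//]]; rewrite -big_nat sa.
rewrite big_nat (eq_bigr (fun=> -2)) => [|n /andP[ti _]]; last first.
  by rewrite ltnNge ti.
rewrite -big_nat sumr_const_nat (_ : 2 * t + 1 - t = t.+1)%N; last by lia.
by rewrite -mulr_natr; lra.
Qed.

Lemma bridge_values_flow sigma tau f r a : orientation sigma tau ->
  triangle_conserving tau f -> nowhere_zero f -> 3 <= r ->
  (forall n, 2 <= a n <= r - 1) -> \sum_(0 <= n < t) a n = 2 * t.+1%:R ->
  exists tau', [/\ orientation sigma tau', is_flow tau' r (spread (bridge_values a))
    & nowhere_zero (spread (bridge_values a))].
Proof.
move=> ori fT fN0 r3 aB /sum_bridge_values sa.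
have [tau' [ori' bd']] := prescribe_bridges ori fT fN0 sa.
have wB i : 2 <= `|bridge_values a i| <= r - 1.
  rewrite /bridge_values; case: ifP => _; last by rewrite normrN normr_nat; lra.
  by have := aB i => ai; rewrite ger0_norm //; lra.
have sB e : 1 <= spread (bridge_values a) e <= r - 1.
  by case: e => [i|[i j]] /=; have := wB i; lra.
exists tau'; split=> //; last first.
  by move=> e; rewrite gt_eqF //; have := sB e; lra.
split=> // [|e]; first by lra.
by right; rewrite ger0_norm //; have := sB e; lra.
Qed.

(** * Lower bounds *)

Lemma flow_balance sigma tau f r m M : orientation sigma tau ->
  is_flow tau r f -> 0 <= m -> (forall i, m <= `|f (inl i)| <= M) ->
  m * t.+1%:R <= M * t%:R.
Proof.
move=> ori [_ _ bd] m0 fB.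
apply: odd_balance m0 _ (etrans (esym (boundary_center tau f)) (bd None)) => i.
by rewrite normrM (norm_incidence R ori) ?mul1r // !inE.
Qed.

Lemma flow_bounds tau f r : is_flow tau r f -> nowhere_zero f ->
  forall e, 1 <= `|f e| <= r - 1.
Proof.
by move=> [_ fB _] fN0 e; case: (fB e) => // /eqP; rewrite (negPf (fN0 e)).
Qed.

(** Every bridge has absolute value between 2 and r - 1, since the edges of its
    triangle have absolute value at least 1. *)
Lemma flow_lower_bound sigma tau f r : (0 < t)%N -> orientation sigma tau ->
  is_flow tau r f -> nowhere_zero f -> 3 + 2 / t%:R <= r.
Proof.
move=> t0 ori ff fN0.
have bd : triangle_conserving tau f by case: ff => _ _ bd i k.
have : 2 * t.+1%:R <= (r - 1) * t%:R.
  apply: (flow_balance ori ff) => // i.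
  have := flow_bounds ff fN0 (inl i); have := bridge_twice ori bd fN0 i ord0.
  by have := flow_bounds ff fN0 (inr (i, ord0)); lra.
by rewrite -natr1 -lerBrDl ler_pdivrMr ?ltr0n //; lra.
Qed.

(** If k <= 4, a bridge of absolute value 2x, with x the integer on the edges
    of its triangle, has 2x <= 3, so x = 1 and every bridge has absolute value
    exactly 2; an odd number of terms 2 and -2 cannot cancel. *)
Lemma int_flow_lower_bound sigma tau f (k : nat) : orientation sigma tau ->
  is_flow tau k%:R f -> nowhere_zero f -> integer_valued f -> (5 <= k)%N.
Proof.
move=> ori ff fN0 fZ; rewrite leqNgt; apply/negP => k5.
have {}k5 : k%:R <= 4 :> R by rewrite ler_nat.
have bd : triangle_conserving tau f by case: ff => _ _ bd i j.
have : 2 * t.+1%:R <= 2 * t%:R :> R.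
  apply: (flow_balance ori ff) => // i.
  have := flow_bounds ff fN0 (inl i); have := bridge_twice ori bd fN0 i ord0.
  have := flow_bounds ff fN0 (inr (i, ord0)).
  have /natr_norm_int/natrP[n ->] := fZ (inr (i, ord0)).
  move=> n1 -> n2.
  have : n%:R <= 1 :> R by rewrite lern1 -ltnS -(ltr_nat R); lra.
  lra.
by rewrite -natr1; lra.
Qed.

(** * A flow-admissible signature *)

Definition all_negative (e : E) : int := -1.

Lemma all_negative_orientation : orientation all_negative (fun=> 1).
Proof. by split=> *; rewrite ?mulr1 ?opprK; auto. Qed.

Lemma incidence_all_positive e v :
  incidence R (fun _ : halfedge (H_graph t) => 1) e v = (v \in ends e)%:R.
Proof.
by rewrite /incidence; case: insubP => [h /= -> _|/= /negPf->].
Qed.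

(** With all half-edges positive, the two edges at each degree-2 vertex must
    cancel, so the edge opposite to the attachment vertex has the sign of the
    bridge and the other two edges the opposite sign. *)
Definition balanced_values (e : E) : R :=
  match e with inl _ => 2 | inr p => if p.2 == ord0 then 1 else -1 end.

Lemma balanced_values_conserving : triangle_conserving (fun=> 1) balanced_values.
Proof.
move=> i k; rewrite boundary_triangle !big_ord_recl big_ord0.
rewrite !incidence_all_positive mem_bridge_ends !mem_triangle_ends !eqxx /=.
by case: k => [[|[|[|//]]]] ? /=; lra.
Qed.

Lemma balanced_values_neq0 : nowhere_zero balanced_values.
Proof.
by case=> [i|[i j]] /=; [|case: ifP => _];
  rewrite ?oppr_eq0 ?pnatr_eq0 ?oner_eq0.
Qed.

(** * Flows attaining the bounds *)

Definition circular_weights (n : nat) : R := 2 + 2 / t%:R.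

Definition integer_weights (n : nat) : R := if n == 0%N then 4 else 2.

Lemma circular_flow_exists sigma tau f : (0 < t)%N -> orientation sigma tau ->
  triangle_conserving tau f -> nowhere_zero f ->
  exists tau', [/\ orientation sigma tau',
    is_flow tau' (3 + 2 / t%:R) (spread (bridge_values circular_weights))
    & nowhere_zero (spread (bridge_values circular_weights))].
Proof.
move=> t0 ori fT fN0; have t0R : 0 < t%:R :> R by rewrite ltr0n.
have t1 : 0 <= 2 / t%:R :> R by rewrite divr_ge0 // ltW.
apply: (bridge_values_flow ori fT fN0); first by lra.
  by move=> n; rewrite /circular_weights; lra.
rewrite sumr_const_nat subn0 -[_ *+ t]mulr_natr -natr1 /circular_weights.
by rewrite mulrDl divfK ?gt_eqF //; lra.
Qed.

Lemma integer_flow_exists sigma tau f : (0 < t)%N -> orientation sigma tau ->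
  triangle_conserving tau f -> nowhere_zero f ->
  exists tau', [/\ orientation sigma tau',
    is_flow tau' 5 (spread (bridge_values integer_weights))
    & nowhere_zero (spread (bridge_values integer_weights))].
Proof.
move=> t0 ori fT fN0; apply: (bridge_values_flow ori fT fN0); first by lra.
  by move=> n; rewrite /integer_weights; case: ifP => _; lra.
rewrite big_ltn // [X in _ + X]big_nat (eq_bigr (fun=> 2)) => [|n]; last first.
  by rewrite /integer_weights; case: n.
rewrite -big_nat sumr_const_nat -[2 *+ (t - 1)]mulr_natr natrB // -natr1 /=.
by lra.
Qed.

Lemma circular_spread_values e : spread (bridge_values circular_weights) e \in
  [:: 1; 1 + 1 / t%:R; 2; 2 + 2 / t%:R].
Proof.
have t0 : 0 <= 2 / t%:R :> R by rewrite divr_ge0.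
rewrite !inE; case: e => [i|[i j]] /=; rewrite /bridge_values; case: ifP => _.
- by rewrite ger0_norm ?eqxx ?orbT //; rewrite /circular_weights; lra.
- by rewrite normrN normr_nat eqxx ?orbT.
- rewrite ger0_norm; last by rewrite /circular_weights; lra.
  by rewrite /circular_weights mulrDl mulrAC divff ?pnatr_eq0 // eqxx orbT.
- by rewrite normrN normr_nat divff ?pnatr_eq0 // eqxx.
Qed.

Lemma integer_spread_values e :
  spread (bridge_values integer_weights) e \in [:: 1; 2; 4].
Proof.
have h : 4 / 2 = 2 :> R by lra.
rewrite !inE; case: e => [i|[i j]] /=; rewrite /bridge_values /integer_weights;
  case: ifP => _; try case: ifP => _;
  by rewrite ?normrN normr_nat ?h ?divff ?pnatr_eq0 ?eqxx ?orbT.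
Qed.

Lemma integer_spread_int : integer_valued (spread (bridge_values integer_weights)).
Proof.
by move=> e; move: (integer_spread_values e);
  rewrite !inE => /or3P[] /eqP ->; rewrite ?natr_int // -[1]/(1%:R) natr_int.
Qed.

(** * The spectra *)

Lemma circular_flow_numberE sigma : (0 < t)%N -> flow_admissible R sigma ->
  circular_flow_number R sigma = (3 + 2 / t%:R)%:E.
Proof.
move=> t0 [r0 [tau [f [ori ff fN0]]]]; apply/le_anti/andP; split.
  apply: ereal_inf_lbound; exists (3 + 2 / t%:R) => //.
  have fT : triangle_conserving tau f by case: ff => _ _ bd i k.
  have [tau' [ori' ff' fN0']] := circular_flow_exists t0 ori fT fN0.
  by exists tau', (spread (bridge_values circular_weights)).
apply: le_ereal_inf_tmp => _ [r [tau' [f' [ori' ff' fN0']]] <-].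
by rewrite lee_fin (flow_lower_bound t0 ori' ff' fN0').
Qed.

Lemma integer_flow_numberE sigma : (0 < t)%N -> flow_admissible R sigma ->
  integer_flow_number R sigma = EFin 5%N.
Proof.
move=> t0 [r0 [tau [f [ori ff fN0]]]].
have fT : triangle_conserving tau f by case: ff => _ _ bd i k.
have ad5 : admits_int_nz_flow R sigma 5.
  have [tau' [ori' ff' fN0']] := integer_flow_exists t0 ori fT fN0.
  exists tau', (spread (bridge_values integer_weights)); split => //.
  exact: integer_spread_int.
rewrite /integer_flow_number; case: pselect => [exk|[]]; last first.
  by exists 5%N; apply/asboolP.
case: ex_minnP => k /asboolP[tau' [f' [ori' ff' fN0' fZ']]] kmin.
congr EFin; apply/eqP; rewrite eqn_leq kmin; last exact/asboolP.
exact: int_flow_lower_bound ori' ff' fN0' fZ'.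
Qed.

Lemma all_negative_signature : signature all_negative.
Proof. by right. Qed.

Lemma all_negative_admissible : (0 < t)%N -> flow_admissible R all_negative.
Proof.
move=> t0; exists (3 + 2 / t%:R).
have [tau []] := circular_flow_exists t0 all_negative_orientation
  balanced_values_conserving balanced_values_neq0.
by exists tau, (spread (bridge_values circular_weights)).
Qed.

End TriangleFlows.

Theorem theorem2p1 (R : realType) (t : nat) (ht : (1 <= t)%N) :
  [/\ flow_spectrum R (H_graph t) = [set (3 + 2 / t%:R)%:E],
      integer_flow_spectrum R (H_graph t) = [set EFin 5%N],
      exists (sigma : edge (H_graph t) -> int)
             (tau : halfedge (H_graph t) -> int)
             (phi : edge (H_graph t) -> R),
        [/\ signature sigma /\ orientation sigma tau,
            is_flow tau 5 phi,
            nowhere_zero phi,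
            integer_valued phi &
            forall e, phi e \in [:: 1; 2; 4]] &
      exists (sigma : edge (H_graph t) -> int)
             (tau : halfedge (H_graph t) -> int)
             (phic : edge (H_graph t) -> R),
        [/\ signature sigma /\ orientation sigma tau,
            is_flow tau (3 + 2 / t%:R) phic,
            nowhere_zero phic &
            forall e, phic e \in [:: 1; 1 + 1 / t%:R; 2; 2 + 2 / t%:R]]].
Proof.
have neg := @all_negative_signature t.
have ori := @all_negative_orientation t.
have fT := @balanced_values_conserving R t.
have fN0 := @balanced_values_neq0 R t.
split.
- apply/seteqP; split=> [_ [sigma [_ adm] <-]|_ ->].
    exact: circular_flow_numberE.
  exists (@all_negative t); first by split=> //; exact: all_negative_admissible.
  by apply: circular_flow_numberE => //; exact: all_negative_admissible.
- apply/seteqP; split=> [_ [sigma [_ adm] <-]|_ ->].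
    exact: integer_flow_numberE.
  exists (@all_negative t); first by split=> //; exact: all_negative_admissible.
  by apply: integer_flow_numberE => //; exact: all_negative_admissible.
- have [tau [ori' ff' fN0']] := integer_flow_exists ht ori fT fN0.
  exists (@all_negative t), tau, (spread (bridge_values (@integer_weights R))).
  by split=> //; [exact: integer_spread_int | exact: integer_spread_values].
- have [tau [ori' ff' fN0']] := circular_flow_exists ht ori fT fN0.
  exists (@all_negative t), tau, (spread (bridge_values (@circular_weights R t))).
  by split=> //; exact: circular_spread_values.
Qed.
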